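(* Let $\hat F$ be a regular admissible extended frame on a domain $\Omega\subset\mathbb R^2$ with coefficients $A^i,B^i$, $F=\hat F|_{\lambda=1}$, and let $\mu\in\mathbb R$, $\mu\ne0,1$. For $t\in\mathbb R$ put $$g^t:=\hat F|_{\lambda=\mu}\,\exp(te_3)\,\hat F|_{\lambda=1}^{-1},$$ so that $g^t=f^\mu\cosh t+N^\mu\sinh t$, where $f^\mu=\hat F|_{\lambda=\mu}\hat F|_{\lambda=1}^{-1}$ and $N^\mu=\hat F|_{\lambda=\mu}e_3\hat F|_{\lambda=1}^{-1}$. Then $$(g^t)^{-1}g^t_x=\mathrm{Ad}_F\Big(A^1(\mu e^{-2t}-1)\xi_1+A^2(e^{2t}-1)\xi_2\Big),$$ $$(g^t)^{-1}g^t_y=\mathrm{Ad}_F\Big(B^1(e^{-2t}-1)\xi_1+B^2(\mu^{-1}e^{2t}-1)\xi_2\Big),$$ and, writing $N^t=g^t\mathrm{Ad}_Fe_3$, $$\langle g^t_x,g^t_x\rangle=A^1A^2(\mu e^{-2t}-1)(e^{2t}-1),\qquad \langle g^t_y,g^t_y\rangle=B^1B^2(e^{-2t}-1)(\mu^{-1}e^{2t}-1),$$ $$\langle g^t_{xx},N^t\rangle=A^1A^2(e^{2t}-\mu e^{-2t}),\qquad \langle g^t_{yy},N^t\rangle=B^1B^2(\mu^{-1}e^{2t}-e^{-2t}).$$ Consequently, for $\mu>0$: (i) if $A^1A^2B^1B^2\ne0$, the coordinates $(x,y)$ are null for $g^t$ (that is, $\langle g^t_x,g^t_x\rangle=\langle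 g^t_y,g^t_y\rangle=0$) exactly for $t=0$ and $t=\tfrac12\log\mu$; (ii) the coefficients $L=\langle g^t_{xx},N^t\rangle$ and $\mathcal N=\langle g^t_{yy},N^t\rangle$ of the second fundamental form of $g^t$ vanish at $t=\tfrac14\log\mu$, and, if $A^1A^2\ne0$ or $B^1B^2\ne0$, they both vanish at no other value of $t$; (iii) at $t=\tfrac14\log\mu$, $g^t$ is an immersion if and only if $A^1B^2-A^2B^1\ne0$, and then $(x,y)$ are asymptotic coordinates for it.
   Context: On the space $\mathfrak{gl}(2,\mathbb R)$ of real $2\times2$ matrices let $\langle X,Y\rangle=-\tfrac12\operatorname{tr}(X\bar Y)$, where $\bar Y=(\operatorname{tr}Y)\mathrm{Id}-Y$; then $\langle X,X\rangle=-\det X$, and anti-de Sitter 3-space is $\mathbb H^3_1=\{\langle X,X\rangle=-1\}=SL(2,\mathbb R)$. Put $e_3=\begin{pmatrix}-1&0\\0&1\end{pmatrix}$, $\xi_1=\begin{pmatrix}0&0\\1&0\end{pmatrix}$, $\xi_2=\begin{pmatrix}0&1\\0&0\end{pmatrix}$, $\mathrm{Ad}_FX=FXF^{-1}$. All maps are smooth; a domain is a connected open set with coordinates $(x,y)$. An admissible extended frame on $\Omega$ is a family of maps $\hat F|_\lambda:\Omega\to SL(2,\mathbb R)$, depending smoothly on $\lambda\in\mathbb R\setminus\{0\}$ (i.e. a map into the loop group $\Lambda SL(2,\mathbb R)$), with $$\hat F^{-1}d\hat F=(\lambda A^1\xi_1+A^2\xi_2+A^3e_3)\,dx+(B^1\xi_1+\lambda^{-1}B^2\xi_2+B^3e_3)\,dy,$$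 where $A^i,B^i$ are real functions of $(x,y)$ independent of $\lambda$. It is regular if $A^1\ne0$ and $B^2\ne0$ everywhere on $\Omega$. Coordinates are asymptotic for an immersion if the diagonal coefficients $L,\mathcal N$ of its second fundamental form vanish (and the second fundamental form is Lorentzian). *)

(* Defs.v *)
From mathcomp Require Import all_boot all_order all_algebra.
From mathcomp Require Import all_classical all_reals all_analysis.
Import GRing.Theory Num.Theory.
Import numFieldNormedType.Exports.

Set Implicit Arguments.
Unset Strict Implicit.
Unset Printing Implicit Defensive.

Local Open Scope classical_set_scope.
Local Open Scope ring_scope.

Definition domain (R : realType) (Om : set (R * R)) : Prop :=
  [/\ open Om, connected Om & Om !=set0].

(* C^k on an open set U, for V finite dimensional: all iterated directional
   derivatives up to order k - 1 are differentiable and those of order k are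
   continuous. *)
Fixpoint Ck_on (R : realType) (V W : normedModType R) (k : nat)
    (U : set V) (f : V -> W) : Prop :=
  if k is k'.+1 then
    (forall p, U p -> differentiable f p) /\
    (forall v, Ck_on k' U (fun p => 'D_v f p))
  else forall p, U p -> {for p, continuous f}.

Definition smooth_on (R : realType) (V W : normedModType R)
    (U : set V) (f : V -> W) : Prop :=
  forall k, Ck_on k U f.

Definition dx (R : realType) (W : normedModType R) (f : R * R -> W)
    (p : R * R) : W := 'D_((1, 0) : R * R) f p.
Definition dy (R : realType) (W : normedModType R) (f : R * R -> W)
    (p : R * R) : W := 'D_((0, 1) : R * R) f p.

Definition cosh (R : realType) (t : R) : R := (expR t + expR (- t)) / 2.
Definition sinh (R : realType) (t : R) : R := (expR t - expR (- t)) / 2.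

Definition mexp (R : realType) (X : 'M[R]_2) : 'M[R]_2 :=
  limn (series (fun k => (k`!%:R)^-1 *: X ^+ k)).

(* X |-> tr(X) Id - X is the adjugate on 2 x 2 matrices, hence
   ip X X = - \det X. *)
Definition mbar (R : realType) (X : 'M[R]_2) : 'M[R]_2 := (\tr X)%:M - X.
Definition ip (R : realType) (X Y : 'M[R]_2) : R :=
  - (2^-1 * \tr (X *m mbar Y)).

Definition AdS3 (R : realType) : set 'M[R]_2 := [set X | ip X X = -1].

Definition e3 (R : realType) : 'M[R]_2 := delta_mx 1 1 - delta_mx 0 0.
Definition xi1 (R : realType) : 'M[R]_2 := delta_mx 1 0.
Definition xi2 (R : realType) : 'M[R]_2 := delta_mx 0 1.

Definition Ad (R : realType) (F X : 'M[R]_2) : 'M[R]_2 := F *m X *m invmx F.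

(* [Fhat l p] is the value of the frame at p for the loop parameter l;
   it is smooth jointly in (p, l), l <> 0. *)
Definition admissible_frame (R : realType) (Om : set (R * R))
    (Fhat : R -> R * R -> 'M[R]_2) (A1 A2 A3 B1 B2 B3 : R * R -> R) : Prop :=
  [/\ smooth_on (Om `*` [set l : R | l != 0])
        (fun q : (R * R) * R => Fhat q.2 q.1),
      [/\ smooth_on Om A1, smooth_on Om A2 & smooth_on Om A3] /\
      [/\ smooth_on Om B1, smooth_on Om B2 & smooth_on Om B3],
      (forall l p, l != 0 -> Om p -> \det (Fhat l p) = 1),
      (forall l p, l != 0 -> Om p ->
         invmx (Fhat l p) *m dx (Fhat l) p =
         (l * A1 p) *: xi1 R + A2 p *: xi2 R + A3 p *: e3 R) &
      (forall l p, l != 0 -> Om p ->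
         invmx (Fhat l p) *m dy (Fhat l) p =
         B1 p *: xi1 R + (l^-1 * B2 p) *: xi2 R + B3 p *: e3 R)].

Definition regular_frame (R : realType) (Om : set (R * R))
    (A1 B2 : R * R -> R) : Prop :=
  forall p, Om p -> A1 p != 0 /\ B2 p != 0.

Definition immersion (R : realType) (Om : set (R * R))
    (f : R * R -> 'M[R]_2) : Prop :=
  [/\ smooth_on Om f,
      (forall p, Om p -> AdS3 (f p)) &
      (forall p, Om p -> injective ('d f p))].

Definition null_at (R : realType) (f : R * R -> 'M[R]_2) (p : R * R) : Prop :=
  ip (dx f p) (dx f p) = 0 /\ ip (dy f p) (dy f p) = 0.

(* The tangent space of AdS3 at f p is the orthogonal complement of f p. *)
Definition unit_normal (R : realType) (Om : set (R * R))
    (f N : R * R -> 'M[R]_2) : Prop :=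
  smooth_on Om N /\
  forall p, Om p ->
    [/\ ip (N p) (N p) = 1, ip (N p) (f p) = 0,
        ip (N p) (dx f p) = 0 & ip (N p) (dy f p) = 0].

(* Coefficients of the second fundamental form of f with unit normal N. *)
Definition sffL (R : realType) (f N : R * R -> 'M[R]_2) (p : R * R) : R :=
  ip (dx (dx f) p) (N p).
Definition sffM (R : realType) (f N : R * R -> 'M[R]_2) (p : R * R) : R :=
  ip (dy (dx f) p) (N p).
Definition sffN (R : realType) (f N : R * R -> 'M[R]_2) (p : R * R) : R :=
  ip (dy (dy f) p) (N p).

Definition sff (R : realType) (f N : R * R -> 'M[R]_2) (p u v : R * R) : R :=
  sffL f N p * (u.1 * v.1) + sffM f N p * (u.1 * v.2 + u.2 * v.1)
  + sffN f N p * (u.2 * v.2).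

(* Signature (1,1); such u and v are necessarily a basis of the plane. *)
Definition lorentzian (R : realType) (b : R * R -> R * R -> R) : Prop :=
  exists u v, [/\ b u u = 1, b v v = -1 & b u v = 0].

Definition asymptotic_coordinates (R : realType) (Om : set (R * R))
    (f N : R * R -> 'M[R]_2) : Prop :=
  [/\ immersion Om f, unit_normal Om f N &
      forall p, Om p ->
        [/\ sffL f N p = 0, sffN f N p = 0 & lorentzian (sff f N p)]].

Definition fmu (R : realType) (Fhat : R -> R * R -> 'M[R]_2) (mu : R)
    (p : R * R) : 'M[R]_2 :=
  Fhat mu p *m invmx (Fhat 1 p).

Definition Nmu (R : realType) (Fhat : R -> R * R -> 'M[R]_2) (mu : R)
    (p : R * R) : 'M[R]_2 :=
  Fhat mu p *m e3 R *m invmx (Fhat 1 p).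

Definition gmap (R : realType) (Fhat : R -> R * R -> 'M[R]_2) (mu t : R)
    (p : R * R) : 'M[R]_2 :=
  Fhat mu p *m mexp (t *: e3 R) *m invmx (Fhat 1 p).

Definition Nt (R : realType) (Fhat : R -> R * R -> 'M[R]_2) (mu t : R)
    (p : R * R) : 'M[R]_2 :=
  gmap Fhat mu t p *m Ad (Fhat 1 p) (e3 R).

(* Main.v *)
From HB Require Import structures.
Require Import Defs.
From mathcomp Require Import all_boot all_order all_algebra.
From mathcomp Require Import all_classical all_reals all_analysis.
From mathcomp Require Import ring lra.
Import Order.TTheory GRing.Theory Num.Theory.
Import numFieldNormedType.Exports.
Local Open Scope classical_set_scope.
Local Open Scope ring_scope.

(* With E = exp(t e3), the product rule and the frame equations give
   d(Fmu C F^-1) = Fmu (Mmu C - C M + dC) F^-1 for every matrix function C,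
   where M and Mmu are the Maurer-Cartan matrices of F and Fmu.  For C = E the
   e3-components cancel, so that g_x = Fmu E W F^-1 with W off-diagonal, while
   N = Fmu E e3 F^-1; applying the same formula to C = E W yields the second
   derivatives.  As the inner product is invariant under multiplication by
   determinant one matrices on either side, all the coefficients reduce to
   explicit 2 x 2 computations. *)

Set Implicit Arguments.
Unset Strict Implicit.
Unset Printing Implicit Defensive.

(** * Continuity of matrix-valued maps and locality of differentiability *)

Lemma matrix_sum_coord (R : realType) (T : Type) m n (f : T -> 'M[R]_(m, n)) :
  f = \sum_i \sum_j (fun p => f p i j *: delta_mx i j).
Proof.
apply/funext => p; rewrite [LHS]matrix_sum_delta fct_sumE.
by apply: eq_bigr => i _; rewrite fct_sumE.
Qed.

(** The map is a finite sum, taken in the space of functions, of its entries times elementary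
    matrices, so [big_ind] propagates continuity through both sums. *)
Lemma continuous_mx (R : realType) (T : topologicalType) m n
    (f : T -> 'M[R]_(m, n)) p :
  (forall i j, {for p, continuous (fun q => f q i j)}) ->
  {for p, continuous f}.
Proof.
move=> fc; rewrite (matrix_sum_coord f).
apply: (big_ind (fun g : T -> 'M[R]_(m, n) => {for p, continuous g})).
- exact: cvg_cst.
- by move=> g h; exact: continuousD.
move=> i _.
apply: (big_ind (fun g : T -> 'M[R]_(m, n) => {for p, continuous g})).
- exact: cvg_cst.
- by move=> g h; exact: continuousD.
by move=> j _; apply: cvgZr_tmp; exact: fc.
Qed.

(** The first-order expansion of [f] at [p] only sees values near [p], hence is also one of [g];
    [diff_unique] then identifies its linear part with the differential of [g]. *)
Lemma near_eq_differentiable (R : realType) (V W : normedModType R)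
    (f g : V -> W) p :
  {near p, f =1 g} -> differentiable f p -> differentiable g p.
Proof.
move=> fg df; have dfc : continuous ('d f p) by exact: diff_continuous.
have fgp : f p = g p by exact: nbhs_singleton fg.
have E : g \o shift p = cst (g p) + 'd f p +o_ 0 id.
  apply/eqaddoP => e e0; have /eqaddoP/(_ _ e0) := diff_locally df.
  have fg0 : \forall h \near (0 : V), f (h + p) = g (h + p).
    by have := fg; rewrite (near_shift 0)/= subr0.
  by apply: filterS2 fg0 => h fgh; rewrite /= !fctE /= fgh fgp.
by apply/diff_locallyP; rewrite (diff_unique dfc E).
Qed.

(** * Closure properties of C^k maps *)

Section Ck.
Context {R : realType} {V : normedModType R}.
Implicit Types (W X Y : normedModType R) (U : set V).

(** Openness of [U] turns equality on [U] into equality near each of its points, which is what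
    directional derivatives depend on. *)
Lemma eq_Ck W k U (f g : V -> W) : open U -> (forall p, U p -> f p = g p) ->
  Ck_on k U f -> Ck_on k U g.
Proof.
move=> oU; elim: k f g => [|k IH] f g fg /= fC.
  move=> p Up; have fgp : {near p, f =1 g}.
    by apply: filterS (open_nbhs_nbhs (conj oU Up)).
  move: (fC p Up); rewrite /prop_for /continuous_at (fg p Up).
  by apply: cvg_trans; exact: near_eq_cvg.
have [df Df] := fC.
have fgp p : U p -> {near p, f =1 g}.
  by move=> Up; apply: filterS (open_nbhs_nbhs (conj oU Up)).
split=> [p Up|v].
  exact: near_eq_differentiable (fgp p Up) (df p Up).
apply: (IH _ _ _ (Df v)) => p Up; apply: near_eq_derive; exact: fgp.
Qed.

Lemma Ck_cst W k U (w : W) : Ck_on k U (fun=> w).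
Proof.
elim: k w => [|k IH] w /=; first by move=> p _; exact: cst_continuous.
split=> [p _|v]; first exact: differentiable_cst.
have -> : (fun p : V => 'D_v (fun=> w) p) = fun=> 0.
  by apply/funext => p; exact: derive_cst.
exact: IH.
Qed.

Lemma CkS W k U (f : V -> W) : Ck_on k.+1 U f -> Ck_on k U f.
Proof.
elim: k f => [|k IH] f [df Df].
  by move=> p Up; exact/differentiable_continuous/df.
by split=> // v; exact/IH/Df.
Qed.

Lemma CkD W k U (f g : V -> W) : open U ->
  Ck_on k U f -> Ck_on k U g -> Ck_on k U (f \+ g).
Proof.
move=> oU; elim: k f g => [|k IH] f g.
  by move=> fC gC p Up; apply: continuousD; [exact: fC|exact: gC].
move=> [df Df] [dg Dg]; split=> [p Up|v].
  by apply: differentiableD; [exact: df|exact: dg].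
apply: (eq_Ck _ _ (IH _ _ (Df v) (Dg v))) => // p Up.
by rewrite deriveD //; apply: diff_derivable; [exact: df|exact: dg].
Qed.

(** A continuous linear map commutes with ['D_v], so the induction hypothesis applies to the
    derivative of [f]. *)
Lemma Ck_linear W X k U (L : {linear W -> X}) (f : V -> W) : open U ->
  continuous L -> Ck_on k U f -> Ck_on k U (L \o f).
Proof.
move=> oU Lc; elim: k f => [|k IH] f.
  by move=> fC p Up; apply: continuous_comp; [exact: fC|exact: Lc].
move=> [df Df]; split=> [p Up|v].
  by apply: differentiable_comp; [exact: df|exact: linear_differentiable].
apply: (eq_Ck _ _ (IH _ (Df v))) => // p Up /=.
have dL : differentiable L (f p) by exact: linear_differentiable.
rewrite [RHS]deriveE; last by apply: differentiable_comp => //; exact: df.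
by rewrite diff_comp //; [rewrite diff_lin //= deriveE //; exact: df|exact: df].
Qed.

(** Leibniz rule, obtained as the chain rule through the pairing of [f] and [g]; joint continuity of
    [B] makes it differentiable. *)
Lemma derive_bilinear W X Y (B : {bilinear W -> X -> Y})
    (f : V -> W) (g : V -> X) p v :
  continuous (fun q => B q.1 q.2) -> differentiable f p -> differentiable g p ->
  differentiable (fun q => B (f q) (g q)) p /\
  'D_v (fun q => B (f q) (g q)) p = B ('D_v f p) (g p) + B (f p) ('D_v g p).
Proof.
move=> Bc df dg.
have dfg : differentiable (fun q => (f q, g q)) p by exact: differentiable_pair.
have dB : differentiable (fun q => B q.1 q.2) (f p, g p).
  exact: differentiable_bilin.
have dBfg : differentiable (fun q => B (f q) (g q)) p.
  exact: (differentiable_comp dfg dB).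
split=> //; rewrite !deriveE //.
rewrite (_ : (fun q => _) = (fun q => B q.1 q.2) \o (fun q => (f q, g q))) //.
by rewrite diff_comp //= diff_bilin // diff_pair //= addrC.
Qed.

(** By the Leibniz rule the derivative is a sum of two bilinear terms, each pairing a derivative
    with an undifferentiated map; [CkS] lowers the order of the latter so that the induction
    hypothesis fits. *)
Lemma Ck_bilinear W X Y k U (B : {bilinear W -> X -> Y})
    (f : V -> W) (g : V -> X) : open U ->
  continuous (fun q => B q.1 q.2) -> Ck_on k U f -> Ck_on k U g ->
  Ck_on k U (fun q => B (f q) (g q)).
Proof.
move=> oU Bc; elim: k f g => [|k IH] f g.
  move=> fC gC p Up.
  apply: (continuous_comp (f := fun q => (f q, g q)) (g := fun q => B q.1 q.2)).
    by apply: cvg_pair; [exact: fC|exact: gC].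
  exact: Bc.
move=> fC gC; have [[df Df] [dg Dg]] := (fC, gC); split=> [p Up|v].
  by have [] := derive_bilinear 0 Bc (df p Up) (dg p Up).
have /(_ oU) := CkD _ (IH _ _ (Df v) (CkS gC)) (IH _ _ (CkS fC) (Dg v)).
apply: eq_Ck => // p Up /=.
by have [_ ->] := derive_bilinear v Bc (df p Up) (dg p Up).
Qed.

End Ck.

(** Passes from joint smoothness in the point and the loop parameter to smoothness at a fixed
    parameter: deriving the slice along [v] is deriving [f] along [(v, 0)]. *)
Lemma Ck_slice (R : realType) (V W X : normedModType R) k (U : set (V * W))
    (f : V * W -> X) c :
  Ck_on k U f -> Ck_on k [set p | U (p, c)] (fun p => f (p, c)).
Proof.
elim: k f => [|k IH] f /=.
  move=> fC p Up; apply: (continuous_comp (f := fun q => (q, c)) (g := f)).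
    by apply: cvg_pair; [exact: cvg_id|exact: cvg_cst].
  by have := fC _ Up.
move=> [df Df]; split=> [p Up|v].
  apply: (differentiable_comp (f := fun q => (q, c)) (g := f)); last exact: df.
  by apply: differentiable_pair.
have -> : (fun p => 'D_v (fun p => f (p, c)) p) =
          fun p => 'D_((v, 0) : V * W) f (p, c).
  apply/funext => p; rewrite /derive.
  apply: (congr1 (fun u : R -> X => lim (u @ 0^'))).
  apply/funext => h /=; congr (_ *: (f _ - _)).
  by apply/pair_equal_spec; split=> //=; rewrite scaler0 add0r.
exact: IH (Df _).
Qed.

Lemma continuous_mulmx (R : realType) m n p :
  continuous (fun q : 'M[R]_(m, n) * 'M[R]_(n, p) => q.1 *m q.2).
Proof.
move=> q; apply: continuous_mx => i j.
have -> : (fun q : 'M[R]_(m, n) * 'M[R]_(n, p) => (q.1 *m q.2) i j) =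
    \sum_k (fun q : 'M[R]_(m, n) * 'M[R]_(n, p) => q.1 i k * q.2 k j).
  by apply/funext => r; rewrite mxE fct_sumE.
apply: (big_ind (fun g : 'M[R]_(m, n) * 'M[R]_(n, p) -> R =>
  {for q, continuous g})).
- exact: cvg_cst.
- by move=> g h; exact: continuousD.
move=> k _; apply: continuousM.
  apply: (continuous_comp (f := fst) (g := fun X : 'M[R]_(m, n) => X i k)).
    exact: cvg_fst.
  exact: coord_continuous.
apply: (continuous_comp (f := snd) (g := fun X : 'M[R]_(n, p) => X k j)).
  exact: cvg_snd.
exact: coord_continuous.
Qed.

(** * Explicit computation with 2 x 2 matrices, and the exponential of [e3] *)

Section mx2.
Context {R : realType}.
Implicit Types (a b c d : R) (X Y : 'M[R]_2).

(** A normal form by rows: the lemmas below push every matrix operation down to the entries, where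
    [ring] and [field] apply. *)
Definition mx2 a b c d : 'M[R]_2 :=
  \matrix_(i, j) if i == 0 then if j == 0 then a else b
                 else if j == 0 then c else d.

Lemma ord2P (P : 'I_2 -> Prop) : P 0 -> P 1 -> forall i, P i.
Proof.
move=> P0 P1 [[|[|//]] ilt].
  by rewrite (_ : Ordinal _ = 0) //; exact/val_inj.
by rewrite (_ : Ordinal _ = 1) //; exact/val_inj.
Qed.

Lemma sum2 (F : 'I_2 -> R) : \sum_i F i = F 0 + F 1.
Proof.
rewrite !big_ord_recl big_ord0 addr0; congr (_ + F _); exact/val_inj.
Qed.

Lemma eq_mx2 X Y : X 0 0 = Y 0 0 -> X 0 1 = Y 0 1 -> X 1 0 = Y 1 0 ->
  X 1 1 = Y 1 1 -> X = Y.
Proof. by move=> *; apply/matrixP; do 2 elim/ord2P. Qed.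

Lemma mx2E X : X = mx2 (X 0 0) (X 0 1) (X 1 0) (X 1 1).
Proof. by apply: eq_mx2; rewrite mxE. Qed.

Lemma addmx2 a b c d a' b' c' d' :
  mx2 a b c d + mx2 a' b' c' d' = mx2 (a + a') (b + b') (c + c') (d + d').
Proof. by apply: eq_mx2; rewrite !mxE. Qed.

Lemma oppmx2 a b c d : - mx2 a b c d = mx2 (- a) (- b) (- c) (- d).
Proof. by apply: eq_mx2; rewrite !mxE. Qed.

Lemma scalemx2 k a b c d : k *: mx2 a b c d = mx2 (k * a) (k * b) (k * c) (k * d).
Proof. by apply: eq_mx2; rewrite !mxE. Qed.

Lemma mulmx2 a b c d a' b' c' d' :
  mx2 a b c d *m mx2 a' b' c' d' =
  mx2 (a * a' + b * c') (a * b' + b * d') (c * a' + d * c') (c * b' + d * d').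
Proof. by apply: eq_mx2; rewrite !mxE !big_ord_recl big_ord0 !mxE /= addr0. Qed.

Lemma trmx2 a b c d : \tr (mx2 a b c d) = a + d.
Proof. by rewrite /mxtrace !big_ord_recl big_ord0 !mxE addr0. Qed.

Lemma detmx2 a b c d : \det (mx2 a b c d) = a * d - b * c.
Proof.
rewrite (expand_det_row _ 0) !big_ord_recl big_ord0 /cofactor !det_mx11 !mxE /=.
by ring.
Qed.

Lemma scalar_mx2 a : a%:M = mx2 a 0 0 a.
Proof. by apply: eq_mx2; rewrite !mxE. Qed.

Lemma mbar_mx2 a b c d : mbar (mx2 a b c d) = mx2 d (- b) (- c) a.
Proof. by rewrite /mbar trmx2 scalar_mx2 oppmx2 addmx2; congr mx2; ring. Qed.

Lemma e3_mx2 : e3 R = mx2 (-1) 0 0 1.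
Proof. by apply: eq_mx2; rewrite !mxE /= ?subr0 ?sub0r. Qed.

Lemma xi1_mx2 : xi1 R = mx2 0 0 1 0.
Proof. by apply: eq_mx2; rewrite !mxE. Qed.

Lemma xi2_mx2 : xi2 R = mx2 0 1 0 0.
Proof. by apply: eq_mx2; rewrite !mxE. Qed.

Lemma ip_mx2 a b c d a' b' c' d' :
  ip (mx2 a b c d) (mx2 a' b' c' d') =
  - (a * d' + d * a' - b * c' - c * b') / 2.
Proof. by rewrite /ip mbar_mx2 mulmx2 trmx2; field. Qed.

(** Polarised multiplicativity of the determinant, [ip] being the polar form of minus the
    determinant. *)
Lemma ipMl P X Y : ip (P *m X) (P *m Y) = \det P * ip X Y.
Proof.
by rewrite (mx2E P) (mx2E X) (mx2E Y) !mulmx2 detmx2 !ip_mx2; field.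
Qed.

Lemma ipMr P X Y : ip (X *m P) (Y *m P) = \det P * ip X Y.
Proof.
by rewrite (mx2E P) (mx2E X) (mx2E Y) !mulmx2 detmx2 !ip_mx2; field.
Qed.

Lemma ip_det X : ip X X = - \det X.
Proof. by rewrite (mx2E X) detmx2 ip_mx2; field. Qed.

Lemma mbar_is_linear : linear (@mbar R).
Proof.
move=> k X Y; rewrite (mx2E X) (mx2E Y) !(mbar_mx2, scalemx2, addmx2).
by congr mx2; ring.
Qed.

HB.instance Definition _ := GRing.isLinear.Build R _ _ _ (@mbar R) mbar_is_linear.

Lemma continuous_mbar : continuous (@mbar R).
Proof.
move=> X; apply: continuous_mx => i j.
have -> : (fun Y : 'M[R]_2 => mbar Y i j) =
    fun Y => (Y 0 0 + Y 1 1) * (i == j)%:R - Y i j.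
  by apply/funext => Y; rewrite /mbar !mxE /mxtrace sum2 mulr_natr.
have C (k l : 'I_2) : {for X, continuous (fun Y : 'M[R]_2 => Y k l)}.
  exact: coord_continuous.
apply: continuousB (C i j); apply: continuousM; last exact: cst_continuous.
exact: continuousD (C 0 0) (C 1 1).
Qed.

Lemma mbarM X Y : mbar (X *m Y) = mbar Y *m mbar X.
Proof.
rewrite (mx2E X) (mx2E Y) !(mbar_mx2, mulmx2).
by congr mx2; ring.
Qed.

Lemma mul_mbar X : X *m mbar X = (\det X)%:M.
Proof.
rewrite (mx2E X) detmx2 mbar_mx2 mulmx2 scalar_mx2.
by congr mx2; ring.
Qed.

Lemma det1_unit X : \det X = 1 -> X \in unitmx.
Proof. by rewrite unitmxE => ->; exact: unitr1. Qed.

(** On determinant one matrices inversion agrees with the linear map [mbar], so its smoothness and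
    its derivative come from those of a linear map. *)
Lemma invmx_mbar X : \det X = 1 -> invmx X = mbar X.
Proof.
move=> dX; apply: (can_inj (mulKmx (det1_unit dX))).
by rewrite mulmxV ?det1_unit // mul_mbar dX.
Qed.

Definition expe3 (t : R) := mx2 (expR (- t)) 0 0 (expR t).

(** The powers of [t *: e3 R] are diagonal, so the matrix series splits into the scalar exponential
    series at [- t] and at [t]. *)
Lemma mexp_e3 t : mexp (t *: e3 R) = expe3 t.
Proof.
rewrite /mexp; apply: cvg_lim; first exact: norm_hausdorff.
have -> : series (fun k => (k`!%:R)^-1 *: (t *: e3 R) ^+ k) =
  fun n => series (exp_coeff (- t)) n *: mx2 1 0 0 0
         + series (exp_coeff t) n *: mx2 0 0 0 1.
  apply/funext => n; rewrite /series /= !scaler_suml -big_split /=.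
  apply: eq_bigr => k _.
  have -> : (t *: e3 R) ^+ k = mx2 ((- t) ^+ k) 0 0 (t ^+ k).
    elim: k => [|k IH]; first by rewrite !expr0 -[1]/(1%:M) scalar_mx2.
    rewrite exprS IH e3_mx2 scalemx2 -mulmxE mulmx2 !exprS.
    by congr mx2; ring.
  by rewrite /exp_coeff /= !scalemx2 addmx2; congr mx2; ring.
have -> : expe3 t = expR (- t) *: mx2 1 0 0 0 + expR t *: mx2 0 0 0 1.
  by rewrite !scalemx2 addmx2 /expe3; congr mx2; ring.
by apply: cvgD; apply: cvgZr_tmp; exact: is_cvg_series_exp_coeff.
Qed.

End mx2.

(** * Smoothness and derivatives of matrix products and inverses *)

Section smooth.
Context {R : realType} {V : normedModType R}.
Implicit Types (U : set V).

Lemma smooth_cst (W : normedModType R) U (w : W) : smooth_on U (fun=> w).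
Proof. by move=> k; exact: Ck_cst. Qed.

Lemma smooth_mulmx U m n q (f : V -> 'M[R]_(m, n)) (g : V -> 'M[R]_(n, q)) :
  open U -> smooth_on U f -> smooth_on U g -> smooth_on U (fun p => f p *m g p).
Proof.
move=> oU fC gC k.
exact: (Ck_bilinear (B := @mulmx R m n q) oU (@continuous_mulmx R m n q)).
Qed.

Lemma smooth_invmx U (f : V -> 'M[R]_2) : open U ->
  (forall p, U p -> \det (f p) = 1) -> smooth_on U f ->
  smooth_on U (fun p => invmx (f p)).
Proof.
move=> oU df fC k; apply: (@eq_Ck _ _ _ _ _ (fun p => mbar (f p))) => //.
  by move=> p Up; rewrite invmx_mbar ?df.
exact: (Ck_linear (L := @mbar R) oU (@continuous_mbar R) (fC k)).
Qed.

Lemma smooth_differentiable (W : normedModType R) U (f : V -> W) p :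
  smooth_on U f -> U p -> differentiable f p.
Proof. by move=> /(_ 1%N)[+ _]; exact. Qed.

Lemma derive_mulmx m n q (f : V -> 'M[R]_(m, n)) (g : V -> 'M[R]_(n, q)) p v :
  differentiable f p -> differentiable g p ->
  differentiable (fun x => f x *m g x) p /\
  'D_v (fun x => f x *m g x) p = 'D_v f p *m g p + f p *m 'D_v g p.
Proof.
exact: (derive_bilinear (B := @mulmx R m n q) v (@continuous_mulmx R m n q)).
Qed.

(** The determinant condition holds near [p], not only at [p], so that the inverse may be replaced
    by [mbar] before differentiating. *)
Lemma derive_frame (G C F : V -> 'M[R]_2) p v (MG MF : 'M[R]_2) :
  (\forall q \near p, \det (F q) = 1) ->
  differentiable G p -> differentiable C p -> differentiable F p ->
  'D_v G p = G p *m MG -> 'D_v F p = F p *m MF -> \tr MF = 0 ->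
  'D_v (fun q => G q *m C q *m invmx (F q)) p =
  G p *m (MG *m C p - C p *m MF + 'D_v C p) *m invmx (F p).
Proof.
move=> detF dG dC dF DG DF trMF.
rewrite (@near_eq_derive _ _ _ _ (fun q => G q *m C q *m mbar (F q))); last first.
  by apply: filterS detF => q /invmx_mbar ->.
have [dGC DGC] := derive_mulmx v dG dC.
have dL : differentiable (@mbar R) (F p).
  exact: linear_differentiable (@continuous_mbar R).
have dmF : differentiable (fun q => mbar (F q)) p.
  exact: (differentiable_comp dF dL).
(* [mbar] reverses products and sends the trace-free [MF] to its opposite. *)
have DmF : 'D_v (fun q => mbar (F q)) p = - (MF *m mbar (F p)).
  rewrite deriveE // (_ : (fun q => _) = @mbar R \o F) //.
  rewrite diff_comp //= diff_lin //=; last exact: continuous_mbar.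
  by rewrite -deriveE // DF mbarM -mulNmx {1}/mbar trMF raddf0 sub0r.
have [_ ->] := derive_mulmx v dGC dmF.
rewrite DGC DG DmF (invmx_mbar (nbhs_singleton detF)).
move: (mbar (F p)) => K.
by rewrite mulmxDr mulmxBr !mulmxDl mulmxN !mulNmx !mulmxA addrAC.
Qed.

(** Meant for [C = E W]: the scalar coefficients of [W] vary, while the matrices [X] and [Y] stay
    constant. *)
Lemma derive_comb (W : normedModType R) (a b : V -> R) (X Y : W) p v :
  differentiable a p -> differentiable b p ->
  differentiable (fun q => a q *: X + b q *: Y) p /\
  'D_v (fun q => a q *: X + b q *: Y) p = 'D_v a p *: X + 'D_v b p *: Y.
Proof.
move=> da db.
have daX : differentiable (fun q => a q *: X) p by exact: differentiableZl.
have dbY : differentiable (fun q => b q *: Y) p by exact: differentiableZl.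
have dab : differentiable ((fun q => a q *: X) + (fun q => b q *: Y)) p.
  exact: differentiableD.
split; first exact: dab.
rewrite deriveE // [LHS](congr1 (fun h => h v) (diffD daX dbY)) /=.
by rewrite !diffZl // !deriveE.
Qed.

End smooth.

(** * Scalar exponentials and the off-diagonal matrices of the first derivatives *)

Lemma expR2 (R : realType) (t : R) : expR (2 * t) = expR t ^+ 2.
Proof. exact: expRM_natl. Qed.

Lemma det_expe3 (R : realType) (t : R) : \det (expe3 t) = 1.
Proof. by rewrite detmx2 mul0r subr0 mulrC expRxMexpNx_1. Qed.

(** This is E^-1 Mmu E - M for the x-direction, with E = exp(t e3): conjugation scales the [xi1]
    component by exp(-2t), the [xi2] component by exp(2t), and fixes the [e3] component, which
    cancels. [Wy] is the analogue in the y-direction. *)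
Definition Wx (R : realType) (A1 A2 : R * R -> R) (mu t : R) p :=
  mx2 0 (A2 p * (expR (2 * t) - 1)) (A1 p * (mu * expR (- (2 * t)) - 1)) 0.

Definition Wy (R : realType) (B1 B2 : R * R -> R) (mu t : R) p :=
  mx2 0 (B2 p * (mu^-1 * expR (2 * t) - 1)) (B1 p * (expR (- (2 * t)) - 1)) 0.

Lemma expR2_eq1 (R : realType) (t : R) : expR (2 * t) = 1 <-> t = 0.
Proof.
split=> [|->]; last by rewrite mulr0 expR0.
by rewrite -[1 in RHS]expR0 => /expR_inj; lra.
Qed.

Lemma expR2_eq (R : realType) (mu t : R) : 0 < mu ->
  expR (2 * t) = mu <-> t = 2^-1 * ln mu.
Proof.
move=> mu_gt0; split=> [<-|->]; first by rewrite expRK mulKf.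
by rewrite mulVKf // lnK.
Qed.

(** The asymptotic value of [t] is handled below through the algebraic condition s^2 = mu with s =
    exp(2t); the logarithm returns only in the final theorem. *)
Lemma expR2_sqr_eq (R : realType) (mu t : R) : 0 < mu ->
  expR (2 * t) ^+ 2 = mu <-> t = 4^-1 * ln mu.
Proof.
move=> mu_gt0; rewrite -expR2 (expR2_eq _ mu_gt0).
by split=> [|->]; lra.
Qed.

Lemma diff_dx_dy (R : realType) (W : normedModType R) (f : R * R -> W) p u v :
  differentiable f p -> 'd f p (u, v) = u *: dx f p + v *: dy f p.
Proof.
move=> df; rewrite /dx /dy !deriveE // -!linearZ -linearD; congr ('d f p _).
apply/pair_equal_spec; split=> /=; rewrite /GRing.scale /=.
  by rewrite mulr1 mulr0 addr0.
by rewrite mulr1 mulr0 add0r.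
Qed.

(** * The Maurer-Cartan equations and the derivatives of the family [g] *)

Section frame.
Context {R : realType} {Om : set (R * R)} {Fhat : R -> R * R -> 'M[R]_2}.
Context {A1 A2 A3 B1 B2 B3 : R * R -> R} {mu : R}.
Context (oOm : open Om).
Context (admF : admissible_frame Om Fhat A1 A2 A3 B1 B2 B3).
Context (mu0 : mu != 0).

Let g := gmap Fhat mu.
Let N := Nt Fhat mu.

Lemma frame_det l p : l != 0 -> Om p -> \det (Fhat l p) = 1.
Proof. by case: admF => _ _ + _ _; apply. Qed.

Lemma frame_smooth l : l != 0 -> smooth_on Om (Fhat l).
Proof.
move=> l0 k; have [FC _ _ _ _] := admF.
(* The slice of the product set at [l] is [Om] because [l] is nonzero. *)
have := Ck_slice l (FC k); congr Ck_on.
by apply/seteqP; split=> p => [[]//|]; split.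
Qed.

Lemma frame_differentiable l p : l != 0 -> Om p -> differentiable (Fhat l) p.
Proof. by move=> /frame_smooth + Op; move/smooth_differentiable; exact. Qed.

Lemma frame_dx l p : l != 0 -> Om p ->
  dx (Fhat l) p = Fhat l p *m mx2 (- A3 p) (A2 p) (l * A1 p) (A3 p).
Proof.
move=> l0 Op; have [_ _ _ /(_ l p l0 Op) Fx _] := admF.
rewrite -[LHS](mulKVmx (det1_unit (frame_det l0 Op))) Fx.
rewrite e3_mx2 xi1_mx2 xi2_mx2 !scalemx2 !addmx2.
by congr (_ *m mx2 _ _ _ _); ring.
Qed.

Lemma frame_dy l p : l != 0 -> Om p ->
  dy (Fhat l) p = Fhat l p *m mx2 (- B3 p) (l^-1 * B2 p) (B1 p) (B3 p).
Proof.
move=> l0 Op; have [_ _ _ _ /(_ l p l0 Op) Fy] := admF.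
rewrite -[LHS](mulKVmx (det1_unit (frame_det l0 Op))) Fy.
rewrite e3_mx2 xi1_mx2 xi2_mx2 !scalemx2 !addmx2.
by congr (_ *m mx2 _ _ _ _); ring.
Qed.

Lemma near_det1 p : Om p -> \forall q \near p, \det (Fhat 1 q) = 1.
Proof.
move=> Op; apply: filterS (open_nbhs_nbhs (conj oOm Op)) => q.
exact: frame_det (oner_neq0 _).
Qed.

Lemma gmapE t p : g t p = Fhat mu p *m expe3 t *m invmx (Fhat 1 p).
Proof. by rewrite /g /gmap mexp_e3. Qed.

(** The inner factors F^-1 F cancel, which puts the normal in the same sandwiched shape as [g] and
    its derivatives, ready for [ip_frame]. *)
Lemma NtE t p : Om p ->
  N t p = Fhat mu p *m (expe3 t *m e3 R) *m invmx (Fhat 1 p).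
Proof.
move=> Op; rewrite /N /Nt -/g gmapE /Ad !mulmxA mulmxKV //.
exact/det1_unit/frame_det/Op/oner_neq0.
Qed.

Lemma ip_frame X Y p : Om p ->
  ip (Fhat mu p *m X *m invmx (Fhat 1 p)) (Fhat mu p *m Y *m invmx (Fhat 1 p)) =
  ip X Y.
Proof.
move=> Op; rewrite ipMr ipMl det_inv !frame_det ?oner_neq0 //.
by rewrite invr1 !mul1r.
Qed.

(** The case of constant [C] in [derive_frame]; the last hypothesis says that [W] is E^-1 Mmu E -
    M1. *)
Lemma derive_gmap t p v (M1 Mmu W : 'M[R]_2) : Om p ->
  'D_v (Fhat 1) p = Fhat 1 p *m M1 -> 'D_v (Fhat mu) p = Fhat mu p *m Mmu ->
  \tr M1 = 0 -> Mmu *m expe3 t - expe3 t *m M1 = expe3 t *m W ->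
  'D_v (g t) p = Fhat mu p *m (expe3 t *m W) *m invmx (Fhat 1 p).
Proof.
move=> Op D1 Dmu tr1 MW.
rewrite (_ : g t = fun q => Fhat mu q *m expe3 t *m invmx (Fhat 1 q)); last first.
  by apply/funext => q; rewrite gmapE.
rewrite (derive_frame (C := fun=> expe3 t) (near_det1 Op) _ _ _ Dmu D1 tr1) //.
- by rewrite MW derive_cst addr0.
- exact: frame_differentiable.
- exact: frame_differentiable (oner_neq0 _) Op.
Qed.

Lemma dx_gmap t p : Om p ->
  dx (g t) p = Fhat mu p *m (expe3 t *m Wx A1 A2 mu t p) *m invmx (Fhat 1 p).
Proof.
move=> Op; apply: (derive_gmap Op (frame_dx (oner_neq0 _) Op) (frame_dx mu0 Op)).
  by rewrite trmx2 addNr.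
rewrite /expe3 /Wx !mulmx2 oppmx2 addmx2 !expRN expR2.
by congr mx2; field; rewrite ?expR_eq0.
Qed.

Lemma dy_gmap t p : Om p ->
  dy (g t) p = Fhat mu p *m (expe3 t *m Wy B1 B2 mu t p) *m invmx (Fhat 1 p).
Proof.
move=> Op; apply: (derive_gmap Op (frame_dy (oner_neq0 _) Op) (frame_dy mu0 Op)).
  by rewrite trmx2 addNr.
rewrite /expe3 /Wy !mulmx2 oppmx2 addmx2 !expRN expR2.
by congr mx2; field; rewrite ?mu0 ?expR_eq0.
Qed.

(** One formula for all second fundamental form coefficients: [h] is a first derivative of [g], [v]
    the second direction, the [x]'s and [y]'s are Maurer-Cartan entries at parameters mu and 1. The
    derivatives of [a] and [b], and the common [e3] component [k], contribute E times off-diagonal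
    matrices only, and these are orthogonal to E e3. *)
Lemma second_derive_normal t p v (h : R * R -> 'M[R]_2) (a b : R * R -> R)
    (x1 x2 y1 y2 k : R) : Om p ->
  (forall q, Om q -> h q =
     Fhat mu q *m (expe3 t *m mx2 0 (b q) (a q) 0) *m invmx (Fhat 1 q)) ->
  differentiable a p -> differentiable b p ->
  'D_v (Fhat 1) p = Fhat 1 p *m mx2 (- k) y2 y1 k ->
  'D_v (Fhat mu) p = Fhat mu p *m mx2 (- k) x2 x1 k ->
  ip ('D_v h p) (N t p) =
  (b p * (x1 * expR (- (2 * t)) + y1) - a p * (x2 * expR (2 * t) + y2)) / 2.
Proof.
move=> Op hE da db D1 Dmu.
pose X := expe3 t *m mx2 0 0 1 0; pose Y := expe3 t *m mx2 0 1 0 0.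
pose C q := a q *: X + b q *: Y.
have CE q : expe3 t *m mx2 0 (b q) (a q) 0 = C q.
  rewrite /C /X /Y !scalemxAr -mulmxDr !scalemx2 addmx2.
  by congr (_ *m mx2 _ _ _ _); ring.
have [dC DC] := derive_comb X Y v da db.
rewrite (@near_eq_derive _ _ _ _
    (fun q => Fhat mu q *m C q *m invmx (Fhat 1 q))); last first.
  by apply: filterS (open_nbhs_nbhs (conj oOm Op)) => q /hE ->; rewrite CE.
rewrite (derive_frame (near_det1 Op) _ dC _ Dmu D1) //; first last.
- by rewrite trmx2 addNr.
- exact: frame_differentiable (oner_neq0 _) Op.
- exact: frame_differentiable.
rewrite NtE // ip_frame // DC /C /X /Y /expe3 e3_mx2.
rewrite !(mulmx2, oppmx2, scalemx2, addmx2) ip_mx2 !expRN expR2.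
by field; rewrite ?expR_eq0.
Qed.

(** * Smoothness, the unit normal and the hyperbolic form of [g] *)

Lemma gmap_smooth t : smooth_on Om (g t).
Proof.
have -> : g t = fun q => Fhat mu q *m expe3 t *m invmx (Fhat 1 q).
  by apply/funext => q; rewrite gmapE.
apply: smooth_mulmx => //; last first.
  apply: smooth_invmx => //; last exact: frame_smooth (oner_neq0 _).
  by move=> q; exact: frame_det (oner_neq0 _).
by apply: smooth_mulmx => //; [exact: frame_smooth|exact: smooth_cst].
Qed.

Lemma Nt_smooth t : smooth_on Om (N t).
Proof.
have iC : smooth_on Om (fun q => invmx (Fhat 1 q)).
  apply: smooth_invmx => //; last exact: frame_smooth (oner_neq0 _).
  by move=> q; exact: frame_det (oner_neq0 _).
apply: smooth_mulmx => //; first exact: gmap_smooth.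
apply: smooth_mulmx => //.
apply: smooth_mulmx => //; last exact: smooth_cst.
exact: frame_smooth (oner_neq0 _).
Qed.

Lemma gmap_det t p : Om p -> \det (g t p) = 1.
Proof.
move=> Op; rewrite gmapE !det_mulmx det_inv det_expe3 !frame_det ?oner_neq0 //.
by rewrite invr1 !mulr1.
Qed.

(** After removal of the outer factors and of E, this is the fact that [e3] has norm 1 and is
    orthogonal to the identity and to off-diagonal matrices. *)
Lemma gmap_unit_normal t : unit_normal Om (g t) (N t).
Proof.
split=> [|p Op]; first exact: Nt_smooth.
rewrite dx_gmap // dy_gmap // NtE // gmapE !ip_frame //.
rewrite e3_mx2 /expe3 /Wx /Wy !mulmx2 !ip_mx2 !expRN.
by split; field; rewrite ?mu0 ?expR_eq0.
Qed.

(** It suffices that exp(t e3) = cosh t Id + sinh t e3, checked on the diagonal entries. *)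
Lemma gmap_hyperbolic t p :
  g t p = cosh t *: fmu Fhat mu p + sinh t *: Nmu Fhat mu p.
Proof.
rewrite gmapE /fmu /Nmu !scalemxAl -mulmxDl; congr (_ *m _).
rewrite -scalemxAl scalemxAr -[X in cosh t *: X]mulmx1 scalemxAr -mulmxDr.
rewrite scalar_mx2 e3_mx2 !scalemx2 addmx2 /expe3.
by congr (_ *m mx2 _ _ _ _); rewrite /cosh /sinh; field.
Qed.

Lemma invmx_gmap t p W : Om p ->
  invmx (g t p) *m (Fhat mu p *m (expe3 t *m W) *m invmx (Fhat 1 p)) =
  Ad (Fhat 1 p) W.
Proof.
move=> Op; apply: (can_inj (mulKmx (det1_unit (gmap_det t Op)))).
rewrite mulKVmx ?det1_unit ?gmap_det // gmapE /Ad !mulmxA.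
by rewrite mulmxKV // det1_unit // frame_det ?oner_neq0.
Qed.

(** * Coefficients of the first and second fundamental forms *)

Lemma ip_dx_gmap t p : Om p -> ip (dx (g t) p) (dx (g t) p) =
  A1 p * A2 p * (mu * expR (- (2 * t)) - 1) * (expR (2 * t) - 1).
Proof.
(* By invariance only minus the determinant of [Wx] remains, that is, the product of its
   off-diagonal entries. *)
move=> Op; rewrite dx_gmap // ip_frame // ipMl det_expe3.
by rewrite ip_mx2; field.
Qed.

Lemma ip_dy_gmap t p : Om p -> ip (dy (g t) p) (dy (g t) p) =
  B1 p * B2 p * (expR (- (2 * t)) - 1) * (mu^-1 * expR (2 * t) - 1).
Proof.
move=> Op; rewrite dy_gmap // ip_frame // ipMl det_expe3.
by rewrite ip_mx2; field.
Qed.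

Lemma coef_differentiable p : Om p ->
  [/\ differentiable A1 p, differentiable A2 p,
      differentiable B1 p & differentiable B2 p].
Proof.
case: admF => _ [[sA1 sA2 _] [sB1 sB2 _]] _ _ _ Op.
by split; apply: smooth_differentiable Op.
Qed.

Let differentiableMr_cst (f : R * R -> R) (c : R) p :
  differentiable f p -> differentiable (fun q => f q * c) p.
Proof. by move=> df; exact: differentiableM. Qed.

Lemma sffL_gmap t p : Om p -> sffL (g t) (N t) p =
  A1 p * A2 p * (expR (2 * t) - mu * expR (- (2 * t))).
Proof.
move=> Op; have [dA1 dA2 _ _] := coef_differentiable Op.
rewrite /sffL (second_derive_normal (t := t) Op
  (fun q Oq => dx_gmap t Oq) (differentiableMr_cst _ dA1) (differentiableMr_cst _ dA2)
  (frame_dx (oner_neq0 _) Op) (frame_dx mu0 Op)).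
by rewrite !expRN; field; rewrite expR_eq0.
Qed.

Lemma sffN_gmap t p : Om p -> sffN (g t) (N t) p =
  B1 p * B2 p * (mu^-1 * expR (2 * t) - expR (- (2 * t))).
Proof.
move=> Op; have [_ _ dB1 dB2] := coef_differentiable Op.
rewrite /sffN (second_derive_normal (t := t) Op
  (fun q Oq => dy_gmap t Oq) (differentiableMr_cst _ dB1) (differentiableMr_cst _ dB2)
  (frame_dy (oner_neq0 _) Op) (frame_dy mu0 Op)).
by rewrite !expRN; field; rewrite expR_eq0 mu0.
Qed.

(** The entries of [Wx] are paired with the Maurer-Cartan matrices in the y-direction. At s^2 = mu
    one has mu / s = s and s / mu = 1 / s, which makes the expression factor through the determinant
    of the immersion criterion. *)
Lemma sffM_gmap t p : Om p -> expR (2 * t) ^+ 2 = mu -> sffM (g t) (N t) p =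
  (expR (2 * t) - 1) * (expR (- (2 * t)) + 1) / 2
  * (A2 p * B1 p - A1 p * B2 p).
Proof.
move=> Op smu; have [dA1 dA2 _ _] := coef_differentiable Op.
rewrite /sffM (second_derive_normal (t := t) Op
  (fun q Oq => dx_gmap t Oq) (differentiableMr_cst _ dA1) (differentiableMr_cst _ dA2)
  (frame_dy (oner_neq0 _) Op) (frame_dy mu0 Op)).
by rewrite -smu !expRN; field; rewrite expR_eq0.
Qed.

(** * Null coordinates, asymptotic coordinates and the immersion criterion *)

Lemma null_atP t p : 0 < mu -> Om p -> A1 p * A2 p * B1 p * B2 p != 0 ->
  null_at (g t) p <-> t = 0 \/ t = 2^-1 * ln mu.
Proof.
move=> mu_gt0 Op; rewrite !mulf_eq0 !negb_or => /andP[/andP[/andP[a1 a2] b1] b2].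
rewrite /null_at (ip_dx_gmap t Op) (ip_dy_gmap t Op) -(expR2_eq1 t) -(expR2_eq t mu_gt0).
have s0 : expR (2 * t) != 0 by rewrite expR_eq0.
(* With s = exp(2t), the x-equation reads (mu / s - 1)(s - 1) = 0 up to a nonzero factor, hence s =
   1 or s = mu; conversely both values annihilate both coefficients. *)
rewrite expRN; move: (expR (2 * t)) s0 => s s0.
split=> [[/eqP + _]|[|] ->]; last first.
- by split; field.
- by split; field.
rewrite !mulf_eq0 (negPf a1) (negPf a2) /= !subr_eq0 => /orP[/eqP E|/eqP ->].
  by right; rewrite -[LHS]mul1r -E mulfVK.
by left.
Qed.

Lemma sff_diag_eq0 t p : Om p -> expR (2 * t) ^+ 2 = mu ->
  sffL (g t) (N t) p = 0 /\ sffN (g t) (N t) p = 0.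
Proof.
move=> Op smu; rewrite sffL_gmap // sffN_gmap // -smu expRN.
by split; field; rewrite expR_eq0.
Qed.

Lemma sff_diag_neq0 t p : Om p -> A1 p * A2 p != 0 \/ B1 p * B2 p != 0 ->
  sffL (g t) (N t) p = 0 /\ sffN (g t) (N t) p = 0 -> expR (2 * t) ^+ 2 = mu.
Proof.
move=> Op; rewrite sffL_gmap // sffN_gmap // expRN.
have s0 : expR (2 * t) != 0 by rewrite expR_eq0.
move: (expR (2 * t)) s0 => s s0 [] ab [/eqP L /eqP M].
  move: L; rewrite mulf_eq0 (negPf ab) subr_eq0 => /eqP E.
  by rewrite expr2 {1}E mulfVK.
move: M; rewrite mulf_eq0 (negPf ab) subr_eq0 => /eqP E.
by apply: (mulfI (invr_neq0 mu0)); rewrite expr2 mulrA E !mulVf.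
Qed.

(** At s^2 = mu the matrices [Wx] and [Wy] share the factor s - 1, nonzero since mu differs from 1.
    What remains of the kernel equation is a linear system in u and v / s whose determinant is, up
    to sign, A1 B2 - A2 B1. *)
Lemma gmap_injP t p : Om p -> A1 p != 0 -> mu != 1 -> expR (2 * t) ^+ 2 = mu ->
  injective ('d (g t) p) <-> A1 p * B2 p - A2 p * B1 p != 0.
Proof.
move=> Op a1 mu1 smu.
have s0 : expR (2 * t) != 0 by rewrite expR_eq0.
have s1 : expR (2 * t) != 1.
  by apply: contra_neq mu1 => s1; rewrite -smu s1 expr1n.
have dg : differentiable (g t) p.
  exact: smooth_differentiable (gmap_smooth t) Op.
have dgE u v : 'd (g t) p (u, v) =
    Fhat mu p *m (expe3 t *m (u *: Wx A1 A2 mu t p + v *: Wy B1 B2 mu t p)) *m invmx (Fhat 1 p).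
  rewrite diff_dx_dy // dx_gmap // dy_gmap //.
  by rewrite !mulmxDr mulmxDl -!scalemxAr -!scalemxAl.
pose s := expR (2 * t).
have WE u v : u *: Wx A1 A2 mu t p + v *: Wy B1 B2 mu t p = (s - 1) *: mx2 0
     (u * A2 p - v / s * B2 p) (u * A1 p - v / s * B1 p) 0.
  rewrite /Wx /Wy !scalemx2 addmx2 expRN -smu -/s.
  by congr mx2; field.
split=> [inj|D].
  apply/negP => /eqP D.
  (* If the determinant vanishes, (B1, s A1) solves the system, and it is nonzero because A1 and s
     are. *)
  suff /inj[/eqP] : 'd (g t) p (B1 p, s * A1 p) = 'd (g t) p (0, 0).
    by move=> _ /eqP; rewrite mulf_eq0 (negPf s0) (negPf a1).
  rewrite !dgE !WE.
  have e1 : B1 p * A2 p - s * A1 p / s * B2 p = 0 * A2 p - 0 / s * B2 p.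
    by rewrite [s * A1 p]mulrC mulfK // !mul0r subr0 -oppr0 -D; ring.
  have e2 : B1 p * A1 p - s * A1 p / s * B1 p = 0 * A1 p - 0 / s * B1 p.
    by field.
  by rewrite e1 e2.
suff ker u v : 'd (g t) p (u, v) = 0 -> u = 0 /\ v = 0.
  move=> [u v] [u' v'] E; apply/pair_equal_spec.
  have [] := ker (u - u') (v - v').
    by rewrite -[(_, _)]/((u, v) - (u', v')) linearB /= E subrr.
  by move=> /subr0_eq -> /subr0_eq ->.
rewrite dgE WE => E.
(* The frames and E are invertible and can be stripped from the kernel equation. *)
have : (s - 1) *: mx2 0 (u * A2 p - v / s * B2 p) (u * A1 p - v / s * B1 p) 0 = 0.
  have U l (l0 : l != 0) := det1_unit (frame_det l0 Op).
  have V : expe3 t \in unitmx by exact/det1_unit/det_expe3.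
  move: E => /(congr1 (mulmx^~ (Fhat 1 p))).
  rewrite mulmxKV ?U ?oner_neq0 // mul0mx => /(congr1 (mulmx (invmx (Fhat mu p)))).
  rewrite mulKmx ?U // mulmx0 => /(congr1 (mulmx (invmx (expe3 t)))).
  by rewrite mulKmx // mulmx0.
move=> /eqP; rewrite scaler_eq0 subr_eq0 (negPf s1) /= => /eqP/matrixP M.
have := M 0 1; have := M 1 0; rewrite !mxE /= => M10 M01.
(* Cramer's rule: eliminating v / s isolates u times the determinant; eliminating u does the same
   for v / s below. *)
have u0 : u = 0.
  apply: (mulIf D); rewrite mul0r.
  transitivity (B2 p * (u * A1 p - v / s * B1 p)
                - B1 p * (u * A2 p - v / s * B2 p)); first by ring.
  by rewrite M10 M01 !mulr0 subr0.
split=> //.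
have v0 : v / s = 0.
  apply: (mulIf D); rewrite mul0r.
  transitivity (A2 p * (u * A1 p - v / s * B1 p)
                - A1 p * (u * A2 p - v / s * B2 p)); first by ring.
  by rewrite M10 M01 !mulr0 subr0.
by rewrite -[v](mulfVK s0) v0 mul0r.
Qed.

Lemma gmap_AdS3 t p : Om p -> AdS3 (g t p).
Proof. by move=> Op; rewrite /AdS3 /= ip_det gmap_det. Qed.

Lemma lorentzian_sff t p : Om p -> mu != 1 -> expR (2 * t) ^+ 2 = mu ->
  A1 p * B2 p - A2 p * B1 p != 0 -> lorentzian (sff (g t) (N t) p).
Proof.
move=> Op mu1 smu D.
have s1 : expR (2 * t) != 1.
  by apply: contra_neq mu1 => s1; rewrite -smu s1 expr1n.
have [L0 N0] := sff_diag_eq0 Op smu.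
have M0 : sffM (g t) (N t) p != 0.
  (* The mixed coefficient is a product of nonzero factors: s - 1, the positive number 1 / s + 1,
     and the determinant up to sign. *)
  have sV1 : expR (- (2 * t)) + 1 != 0 by rewrite gt_eqF // addr_gt0 ?expR_gt0.
  have D' : A2 p * B1 p - A1 p * B2 p != 0 by rewrite -oppr_eq0 opprB.
  rewrite sffM_gmap // mulf_neq0 // mulf_neq0 // mulf_neq0 // subr_eq0 //.
(* With vanishing diagonal coefficients the form is M (u1 v2 + u2 v1); the vectors (1, c) and (1,
   -c) are orthogonal with squares 2 M c and -2 M c, so c = 1 / (2 M) normalises them. *)
exists (1, (2 * sffM (g t) (N t) p)^-1), (1, - (2 * sffM (g t) (N t) p)^-1).
by rewrite /sff L0 N0; split=> /=; field.
Qed.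

End frame.

Theorem lemma5p7 (R : realType) (Om : set (R * R))
    (Fhat : R -> R * R -> 'M[R]_2) (A1 A2 A3 B1 B2 B3 : R * R -> R) (mu : R)
    (domOm : domain Om)
    (admF : admissible_frame Om Fhat A1 A2 A3 B1 B2 B3)
    (regF : regular_frame Om A1 B2)
    (mu_neq0 : mu != 0) (mu_neq1 : mu != 1) :
  let F := Fhat 1 in
  let g := gmap Fhat mu in
  let N := Nt Fhat mu in
  (forall t p, Om p ->
     [/\ g t p = cosh t *: fmu Fhat mu p + sinh t *: Nmu Fhat mu p,
         invmx (g t p) *m dx (g t) p =
           Ad (F p) ((A1 p * (mu * expR (- (2 * t)) - 1)) *: xi1 R
                     + (A2 p * (expR (2 * t) - 1)) *: xi2 R) &
         invmx (g t p) *m dy (g t) p =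
           Ad (F p) ((B1 p * (expR (- (2 * t)) - 1)) *: xi1 R
                     + (B2 p * (mu^-1 * expR (2 * t) - 1)) *: xi2 R)]) /\
  (forall t p, Om p ->
     [/\ ip (dx (g t) p) (dx (g t) p) =
           A1 p * A2 p * (mu * expR (- (2 * t)) - 1) * (expR (2 * t) - 1),
         ip (dy (g t) p) (dy (g t) p) =
           B1 p * B2 p * (expR (- (2 * t)) - 1) * (mu^-1 * expR (2 * t) - 1),
         ip (dx (dx (g t)) p) (N t p) =
           A1 p * A2 p * (expR (2 * t) - mu * expR (- (2 * t))) &
         ip (dy (dy (g t)) p) (N t p) =
           B1 p * B2 p * (mu^-1 * expR (2 * t) - expR (- (2 * t)))]) /\
  (0 < mu ->
     (* (i) *)
     ((forall p, Om p -> A1 p * A2 p * B1 p * B2 p != 0 ->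
         forall t, null_at (g t) p <-> t = 0 \/ t = 2^-1 * ln mu) /\
      ((forall p, Om p -> A1 p * A2 p * B1 p * B2 p != 0) ->
         forall t, (forall p, Om p -> null_at (g t) p) <->
                   t = 0 \/ t = 2^-1 * ln mu)) /\
     (* (ii) *)
     (let t0 := 4^-1 * ln mu in
      (forall p, Om p ->
         sffL (g t0) (N t0) p = 0 /\ sffN (g t0) (N t0) p = 0) /\
      (forall p, Om p -> A1 p * A2 p != 0 \/ B1 p * B2 p != 0 ->
         forall t, t <> t0 ->
           ~ (sffL (g t) (N t) p = 0 /\ sffN (g t) (N t) p = 0))) /\
     (* (iii) *)
     (let t0 := 4^-1 * ln mu in
      [/\ forall p, Om p ->
            injective ('d (g t0) p) <-> A1 p * B2 p - A2 p * B1 p != 0,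
          immersion Om (g t0) <->
            (forall p, Om p -> A1 p * B2 p - A2 p * B1 p != 0) &
          immersion Om (g t0) ->
            asymptotic_coordinates Om (g t0) (N t0)])).
Proof.
move=> F g N.
have oOm : open Om by case: domOm.
have L := sffL_gmap oOm admF mu_neq0.
have M := sffN_gmap oOm admF mu_neq0.
split; [|split].
- move=> t p Op; split.
  + exact: gmap_hyperbolic.
  + rewrite (dx_gmap oOm admF mu_neq0) // (invmx_gmap admF) //; congr Ad.
    rewrite xi1_mx2 xi2_mx2 !scalemx2 addmx2 /Wx.
    by congr mx2; ring.
  + rewrite (dy_gmap oOm admF mu_neq0) // (invmx_gmap admF) //; congr Ad.
    rewrite xi1_mx2 xi2_mx2 !scalemx2 addmx2 /Wy.
    by congr mx2; ring.
- move=> t p Op; split; [| |exact: L|exact: M].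
  + exact: (ip_dx_gmap oOm admF).
  + exact: (ip_dy_gmap oOm admF).
move=> mu_gt0; split; [|split].
- have null := null_atP oOm admF mu_neq0 _ mu_gt0.
  split=> [p Op D t|D t]; first exact: null.
  split=> [nul|t0 p Op]; last exact/null/t0/D.
  (* The domain is nonempty, and nullity at a single point already determines [t]. *)
  have [_ _ [p Op]] := domOm.
  exact/(null t p Op (D p Op))/nul.
- move=> t0; have smu : expR (2 * t0) ^+ 2 = mu by exact/expR2_sqr_eq.
  split=> [p Op|p Op D t tt0 LN0].
    exact: (sff_diag_eq0 oOm admF mu_neq0 Op smu).
  apply: tt0; apply/(expR2_sqr_eq t mu_gt0).
  exact: (sff_diag_neq0 oOm admF mu_neq0 Op D LN0).
move=> t0; have smu : expR (2 * t0) ^+ 2 = mu by exact/expR2_sqr_eq.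
(* Regularity of the frame supplies the condition that A1 is nonzero. *)
have inj p : Om p -> injective ('d (g t0) p) <-> A1 p * B2 p - A2 p * B1 p != 0.
  by move=> Op; apply: (gmap_injP oOm admF) => //; case: (regF p Op).
split=> //.
- split=> [[_ _ immg] p Op|D]; first exact/inj/immg.
  split=> [|p Op|p Op]; last exact/inj/D.
    exact: (gmap_smooth oOm admF).
  exact: (gmap_AdS3 admF).
move=> immg; split=> //; first exact: (gmap_unit_normal oOm admF).
move=> p Op; have [L0 N0] := sff_diag_eq0 oOm admF mu_neq0 Op smu.
split; [exact: L0|exact: N0|].
(* The immersion hypothesis enters through injectivity of the differential, which makes the
   determinant nonzero at [p]. *)
apply: (lorentzian_sff oOm admF mu_neq0 Op mu_neq1 smu).
by case: immg => _ _ /(_ p Op)/(inj p Op).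
Qed.
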